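(* Let $(\mathfrak g,\cdot)$ be a commutative associative algebra, let $D$ be a derivation of $(\mathfrak g,\cdot)$, and let $f\in\mathfrak g^*$ satisfy $f(D(x)\cdot y)=f(x\cdot D(y))$ for all $x,y\in\mathfrak g$. Let $N$ be a Nijenhuis operator on $(\mathfrak g,\cdot)$ satisfying $DN=ND$. Then $N$ is a Nijenhuis operator on the $3$-Lie algebra $\mathfrak g$ with bracket $$[x,y,z]=f(x)(D(y)\cdot z-D(z)\cdot y)+f(y)(D(z)\cdot x-D(x)\cdot z)+f(z)(D(x)\cdot y-D(y)\cdot x).$$
   Context: A linear map $N$ on an associative algebra $(\mathfrak g,\cdot)$ is a Nijenhuis operator if $Nx\cdot Ny=N(Nx\cdot y+x\cdot Ny-N(x\cdot y))$ for all $x,y\in\mathfrak g$. A $3$-Lie algebra is a vector space $\mathfrak g$ with a trilinear skew-symmetric bracket satisfying $[x_1,x_2,[y_1,y_2,y_3]]=[[x_1,x_2,y_1],y_2,y_3]+[y_1,[x_1,x_2,y_2],y_3]+[y_1,y_2,[x_1,x_2,y_3]]$. It is a known fact that the bracket in the claim is a $3$-Lie algebra structure. A linear map $N$ on a $3$-Lie algebra is a Nijenhuis operator if $[Nx,Ny,Nz]=N([x,y,z]_N^2)$ for all $x,y,z$, where $[x,y,z]_N^1=[Nx,y,z]+[x,Ny,z]+[x,y,Nz]-N[x,y,z]$ and $[x,y,z]_N^2=[Nx,Ny,z]+[x,Ny,Nz]+[Nx,y,Nz]-N([x,y,z]_N^1)$. *)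

(* Defs.v *)
From mathcomp Require Import all_boot all_algebra.
Set Implicit Arguments.
Unset Strict Implicit.
Unset Printing Implicit Defensive.
Import GRing.Theory.
Local Open Scope ring_scope.

(* MathComp's algebras are unital, whereas the algebras here need not be: the
   product of an associative algebra is a [{bilinear g -> g -> g}] that is
   [associative]. *)
Section AssociativeAlgebra.
Variables (K : fieldType) (g : lmodType K) (mul : {bilinear g -> g -> g}).

Definition derivation (D : {linear g -> g}) : Prop :=
  forall x y, D (mul x y) = mul (D x) y + mul x (D y).

Definition nijenhuis (N : {linear g -> g}) : Prop :=
  forall x y, mul (N x) (N y) = N (mul (N x) y + mul x (N y) - N (mul x y)).

End AssociativeAlgebra.

(* [bracket_skew12] and [bracket_skew23] are skew-symmetry under the two
   adjacent transpositions, which generate the symmetric group. *)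
Record threeLie (K : fieldType) (g : lmodType K) := ThreeLie {
  bracket :> g -> g -> g -> g;
  bracket_linear1 : forall y z, linear (fun x => bracket x y z);
  bracket_linear2 : forall x z, linear (fun y => bracket x y z);
  bracket_linear3 : forall x y, linear (fun z => bracket x y z);
  bracket_skew12 : forall x y z, bracket y x z = - bracket x y z;
  bracket_skew23 : forall x y z, bracket x z y = - bracket x y z;
  bracket_fundamental : forall x1 x2 y1 y2 y3,
    bracket x1 x2 (bracket y1 y2 y3) =
      bracket (bracket x1 x2 y1) y2 y3
      + bracket y1 (bracket x1 x2 y2) y3
      + bracket y1 y2 (bracket x1 x2 y3)
}.

Section ThreeLieNijenhuis.
Variables (K : fieldType) (g : lmodType K) (L : threeLie g).
Variable N : {linear g -> g}.

Definition bracketN1 (x y z : g) : g :=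
  L (N x) y z + L x (N y) z + L x y (N z) - N (L x y z).

Definition bracketN2 (x y z : g) : g :=
  L (N x) (N y) z + L x (N y) (N z) + L (N x) y (N z) - N (bracketN1 x y z).

Definition threeLie_nijenhuis : Prop :=
  forall x y z, L (N x) (N y) (N z) = N (bracketN2 x y z).

End ThreeLieNijenhuis.

Definition derivation_bracket (K : fieldType) (g : lmodType K)
    (mul : {bilinear g -> g -> g}) (D : {linear g -> g}) (f : {scalar g})
    (x y z : g) : g :=
  f x *: (mul (D y) z - mul (D z) y)
  + f y *: (mul (D z) x - mul (D x) z)
  + f z *: (mul (D x) y - mul (D y) x).

(* A Lie bracket [w] together with a linear form [f] vanishing on [w] yields a
   3-Lie bracket; [derivation_bracket] is the case w x y = D x . y - D y . x. *)
Section LieThreeLie.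
Variables (K : fieldType) (g : lmodType K) (w : g -> g -> g) (f : {scalar g}).
Hypothesis wP : forall x, linear (w x).
Hypothesis wC : forall x y, w y x = - w x y.
Hypothesis jacobi : forall x y z, w x (w y z) = w (w x y) z + w y (w x z).
Hypothesis fw : forall x y, f (w x y) = 0.

Definition lie_bracket3 (x y z : g) : g :=
  f x *: w y z + f y *: w z x + f z *: w x y.

Local Notation br := lie_bracket3.

Let wDr x u v : w x (u + v) = w x u + w x v.
Proof. by have := wP x 1 u v; rewrite !scale1r. Qed.

Let w0 x : w x 0 = 0.
Proof. by apply: (addrI (w x 0)); rewrite -wDr !addr0. Qed.

Let wZr x a u : w x (a *: u) = a *: w x u.
Proof. by have := wP x a u 0; rewrite w0 !addr0. Qed.

Let wDl x u v : w (u + v) x = w u x + w v x.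
Proof. by rewrite wC wDr opprD -!wC. Qed.

Let wZl x a u : w (a *: u) x = a *: w u x.
Proof. by rewrite wC wZr -scalerN -wC. Qed.

Let fbr x y z : f (br x y z) = 0.
Proof. by rewrite /br !raddfD /= !linearZ /= !fw !mulr0 !addr0. Qed.

Lemma lie_bracket3_skew12 x y z : br y x z = - br x y z.
Proof.
rewrite /br (wC x y) (wC z x) (wC y z) !scalerN !opprD.
by rewrite [in LHS](addrC (- _)).
Qed.

Lemma lie_bracket3_skew23 x y z : br x z y = - br x y z.
Proof.
rewrite /br (wC x y) (wC z x) (wC y z) !scalerN !opprD.
by rewrite addrAC.
Qed.

Lemma lie_bracket3_linear3 x y : linear (fun z => br x y z).
Proof.
move=> a u v; rewrite /br linearP /= wP wDl wZl.
rewrite scalerDl !scalerDr !scalerA (mulrC (f x)) (mulrC (f y)).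
by rewrite [X in X + _ = _]addrACA [LHS]addrACA.
Qed.

Lemma lie_bracket3_linear2 x z : linear (fun y => br x y z).
Proof.
move=> a u v; rewrite !(lie_bracket3_skew23 x z).
by rewrite lie_bracket3_linear3 opprD scalerN.
Qed.

Lemma lie_bracket3_linear1 y z : linear (fun x => br x y z).
Proof.
move=> a u v; rewrite !(lie_bracket3_skew12 y).
by rewrite lie_bracket3_linear2 opprD scalerN.
Qed.

Lemma lie_bracket3_fundamental x1 x2 y1 y2 y3 :
  br x1 x2 (br y1 y2 y3) =
    br (br x1 x2 y1) y2 y3 + br y1 (br x1 x2 y2) y3 + br y1 y2 (br x1 x2 y3).
Proof.
pose A u := f x1 *: w x2 u - f x2 *: w x1 u.
have brA u : br x1 x2 u = A u + f u *: w x1 x2.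
  by rewrite /br (wC x1 u) scalerN.
have A_D u v : A (u + v) = A u + A v.
  by rewrite /A !wDr !scalerDr opprD addrACA.
have A_Z a u : A (a *: u) = a *: A u.
  by rewrite /A !wZr scalerBr !scalerA ![a * _]mulrC.
have A_der u v : A (w u v) = w (A u) v + w u (A v).
  rewrite /A (jacobi x2) (jacobi x1) -!scaleNr !wDl !wDr !wZl !wZr !scalerDr.
  by rewrite addrACA.
rewrite (brA (br _ _ _)) fbr scale0r addr0.
rewrite {2 4 6}/br !fbr !scale0r !add0r !addr0 {1}/br !A_D !A_Z !A_der !brA.
set c := w x1 x2; clearbody A c.
rewrite !wDl !wDr !wZl !wZr (wC y1 c) (wC y2 c) (wC y3 c) !scalerDr !scalerN.
rewrite !scalerA (mulrC (f y2) (f y1)) (mulrC (f y3) (f y1)).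
rewrite (mulrC (f y3) (f y2)).
rewrite !addrA [RHS](ACl ((5*9)*(11*1)*(3*7)*(2*6)*(10*4)*(8*12)))%AC /=.
by rewrite !subrr !addr0 !addrA.
Qed.
End LieThreeLie.

Section DerivationThreeLie.
Variables (K : fieldType) (g : lmodType K) (mul : {bilinear g -> g -> g}).
Hypotheses (mulA : associative mul) (mulC : commutative mul).
Variable D : {linear g -> g}.
Hypothesis derD : derivation mul D.
Variable f : {scalar g}.
Hypothesis fD : forall x y, f (mul (D x) y) = f (mul x (D y)).

Let w (x y : g) : g := mul (D x) y - mul (D y) x.

Let wC x y : w y x = - w x y.
Proof. by rewrite /w opprB. Qed.

Let wP x : linear (w x).
Proof.
move=> a u v.
by rewrite /w linearP linearPr linearPl scalerBr opprD addrACA.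
Qed.

Let fw x y : f (w x y) = 0.
Proof. by rewrite /w raddfB /= fD mulC subrr. Qed.

Let mulAC a x y : mul (mul a x) y = mul (mul a y) x.
Proof. by rewrite -mulA (mulC x) mulA. Qed.

Let h x y z := mul (mul (D x) (D y)) z + mul (mul (D (D z)) x) y.

Let hC x y z : h x y z = h y x z.
Proof. by rewrite /h (mulC (D x)) -!mulA (mulC x). Qed.

Let wwE x y z : w x (w y z) = h x y z - h x z y.
Proof.
rewrite /w [D (_ - _)]raddfB /= !derD (mulC (D z) (D y)).
rewrite opprD addrACA subrr addr0.
rewrite linearBr linearBl /h !mulA opprB (mulAC (D (D z))) (mulAC (D (D y)) x).
by rewrite opprD [RHS]addrACA.
Qed.

Let jacobi x y z : w x (w y z) = w (w x y) z + w y (w x z).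
Proof.
rewrite (wC z (w x y)) !wwE opprB (hC y x) (hC y z) (hC z x).
by rewrite [RHS]addrC addrA subrK.
Qed.

Definition derivation_threeLie : threeLie g :=
  @ThreeLie K g (derivation_bracket mul D f)
    (lie_bracket3_linear1 f wP wC) (lie_bracket3_linear2 f wP wC)
    (lie_bracket3_linear3 f wP wC) (lie_bracket3_skew12 f wC)
    (lie_bracket3_skew23 f wC) (lie_bracket3_fundamental wP wC jacobi fw).

End DerivationThreeLie.

(* Main.v *)
(* Put w x y = D x . y - D y . x, so that [x,y,z] is the cyclic sum of f(x) w y z.
   As N commutes with D, it is a Nijenhuis operator for w.  Each cyclic summand
   satisfies the ternary Nijenhuis identity separately: in [x,y,z]_N^2 the terms
   containing f(x) cancel by the identity for w, and N maps the terms containing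
   f(N x) to f(N x) w (N y) (N z). *)
Require Import Defs.
From mathcomp Require Import all_boot all_algebra.
Set Implicit Arguments.
Unset Strict Implicit.
Unset Printing Implicit Defensive.
Import GRing.Theory.
Local Open Scope ring_scope.

Lemma lie_bracket3_nijenhuis (K : fieldType) (g : lmodType K)
    (w : g -> g -> g) (f : {scalar g}) (N : {linear g -> g})
    (br := lie_bracket3 w f) :
  (forall x y, w (N x) (N y) = N (w (N x) y + w x (N y) - N (w x y))) ->
  forall x y z,
  br (N x) (N y) (N z) =
    N (br (N x) (N y) z + br x (N y) (N z) + br (N x) y (N z)
       - N (br (N x) y z + br x (N y) z + br x y (N z) - N (br x y z))).
Proof.
move=> wN x y z.
(* [t] is one cyclic summand of [br]; [n1] and [n2] mirror [bracketN1] and [bracketN2] for it. *)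
pose t u v s := f u *: w v s.
pose n1 u v s := t (N u) v s + t u (N v) s + t u v (N s) - N (t u v s).
pose n2 u v s :=
  t (N u) (N v) s + t u (N v) (N s) + t (N u) v (N s) - N (n1 u v s).
have NZ a v : N (a *: v) = a *: N v by rewrite linearZ.
have tN u v s : t (N u) (N v) (N s) = N (n2 u v s).
  (* Under [N], the three terms weighted by [f u] collapse by the identity for [w]. *)
  have n1E : N (n1 u v s) = t u (N v) (N s) + N (t (N u) v s).
    rewrite /n1 -!addrA raddfD [LHS]addrC; congr (_ + _).
    by rewrite /t wN -!NZ !scalerDr scalerN NZ addrA.
  rewrite /n2 n1E (addrAC (t _ _ _)) opprD addrA addrK.
  by rewrite /t wN -!NZ !scalerDr scalerN NZ.
have brE u v s : br u v s = t u v s + t v s u + t s u v by [].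
have add3 (a b c d e h : g) :
    a + b + c + (d + e + h) = (a + d) + (b + e) + (c + h).
  by rewrite addrACA (addrACA a).
rewrite [LHS]brE !tN -!raddfD; congr (N _).
have -> : br (N x) y z + br x (N y) z + br x y (N z) - N (br x y z)
    = n1 x y z + n1 y z x + n1 z x y.
  rewrite /n1 -[RHS]add3 -!opprD -!raddfD !brE; congr (_ - _).
  (* The nine terms, grouped by which argument carries [N], are regrouped by the argument fed to
     [f]. *)
  by rewrite !addrA [LHS](ACl (1*4*7*5*8*2*9*3*6))%AC.
rewrite /n2 -[LHS]add3 -!opprD -!raddfD !brE; congr (_ - _).
by rewrite !addrA [RHS](ACl (1*4*7*5*8*2*9*3*6))%AC.
Qed.

Theorem proposition4p4 (K : fieldType) (g : lmodType K)
    (mul : {bilinear g -> g -> g})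
    (mulA : associative mul) (mulC : commutative mul)
    (D : {linear g -> g}) (derD : derivation mul D)
    (f : {scalar g}) (fD : forall x y : g, f (mul (D x) y) = f (mul x (D y)))
    (N : {linear g -> g}) (nijN : nijenhuis mul N)
    (DN : forall x : g, D (N x) = N (D x)) :
  threeLie_nijenhuis (derivation_threeLie mulA mulC derD fD) N.
Proof.
pose w x y : g := mul (D x) y - mul (D y) x.
(* [derivation_bracket] unfolds to [lie_bracket3 w f], so only the binary identity for [w]
   remains. *)
apply: (@lie_bracket3_nijenhuis K g w f N) => x y.
(* Once [D] is moved inside [N], [nijN] applies to the pairs [(D x, y)] and [(D y, x)]. *)
rewrite /w !DN !nijN -raddfB /=; congr (N _).
rewrite (mulC (N (D y)) x) (mulC (D y) (N x)) !raddfB /=.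
by rewrite [LHS]addrACA (addrC (mul x _)) !opprD (addrACA (mul _ _) (mul _ _)).
Qed.
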